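(* A sofic shift $X$ satisfies Condition $(\ast)$ if and only if the left Krieger cover of $X$ is the maximal essential subgraph of the past set cover of $X$.
   Context: A shift space over a finite alphabet $\mathcal{A}$ is a closed shift-invariant $X\subseteq\mathcal{A}^{\mathbb{Z}}$; it is sofic if it is the set of label sequences of biinfinite paths in a finite labelled graph. $\mathcal{B}(X)$ is the language of $X$ (finite factors of elements); $X^-$, $X^+$ are the sets of left-rays and right-rays of elements of $X$. For a word or right-ray $x$, $P_\infty(x)$ is the set of left-rays in $X^-$ that may precede $x$ in $X$. For $l\in\mathbb{N}$ and $x\in\mathcal{B}(X)\cup X^+$, let $P_l(x)$ be the set of words $v\in\mathcal{B}(X)$ with $|v|\le l$ such that $vx$ is allowed (i.e. $vx\in\mathcal{B}(X)$ if $x$ is a word, $vx\in X^+$ if $x$ is a right-ray). Condition $(\ast)$: for every $l\in\mathbb{N}$ and every infinite $F\subseteq\mathcal{B}(X)$ such that $P_l(u)=P_l(v)$ for all $u,v\in F$, there exists $x^+\in X^+$ such that $P_l(w)=P_l(x^+)$ for all $w\in F$. Left Krieger cover: the labelled graph with vertex set $\{P_\infty(x^+)\mid x^+\in X^+\}$ and an edge labelled $a$ from $P$ to $P'$ iff there is $x^+\in X^+$ with $P=P_\infty(ax^+)$, $P'=P_\infty(x^+)$. Past set cover: the labelled graph with vertex set $\{P_\infty(w)\mid w\in\mathcal{B}(X)\}$ and an edge labelled $a$ from $P$ to $P'$ iff there is $w\in\mathcal{B}(X)$ with $P=P_\infty(aw)$, $P'=P_\infty(w)$ (where $aw\in\mathcal{B}(X)$).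 A graph is essential if every vertex emits and receives an edge. *)

(* Defs.v *)
From HB Require Import structures.
From mathcomp Require Import all_boot all_order all_algebra.
From mathcomp Require Import all_classical.
From mathcomp Require Import topology.

Set Implicit Arguments.
Unset Strict Implicit.
Unset Printing Implicit Defensive.

Local Open Scope classical_set_scope.
Local Open Scope ring_scope.

Section SymbolicDynamics.
Variable A : finType.

Definition shift (x : int -> A) : int -> A := fun i => x (i + 1).

(** Product topology on A^Z, A being discrete. *)
Definition full_shift : Type :=
  prod_topology (fun _ : int => discrete_topology A).
HB.instance Definition _ := Topological.on full_shift.

Definition shift_space (X : set (int -> A)) : Prop :=
  closed (X : set full_shift) /\ shift @` X = X.

(** The presenting graph may have parallel edges, even with equal labels; a
    biinfinite path is the sequence of its edges. *)
Definition sofic (X : set (int -> A)) : Prop :=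
  exists (V E : finType) (src tgt : E -> V) (lab : E -> A),
    X = [set x | exists p : int -> E,
           (forall i, tgt (p i) = src (p (i + 1))) /\
           (forall i, lab (p i) = x i)].

Definition sofic_shift (X : set (int -> A)) : Prop :=
  shift_space X /\ sofic X.

(** A right-ray r stands for r 0, r 1, r 2, ... at the positions 0, 1, 2, ...;
    a left-ray y is numbered from right to left, y n being the symbol at
    position -(n + 1), which is [Negz n]. *)
Definition right_ray := nat -> A.
Definition left_ray := nat -> A.

Definition right_rays (X : set (int -> A)) : set right_ray :=
  [set r | exists2 x, X x & forall n, r n = x (Posz n)].

Definition left_rays (X : set (int -> A)) : set left_ray :=
  [set y | exists2 x, X x & forall n, y n = x (Negz n)].

(** The empty word belongs to the language as soon as X is nonempty. *)
Definition language (X : set (int -> A)) : set (seq A) :=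
  [set w | exists2 x, X x &
     exists i : int, w = mkseq (fun k => x (i + k%:Z)) (size w)].

(** In the next two definitions the default value of [nth] is used past the end
    of the word. *)
Definition word_ray (w : seq A) (r : right_ray) : right_ray :=
  fun n => nth (r (n - size w)%N) w n.

Definition ray_word (y : left_ray) (w : seq A) : left_ray :=
  fun n => nth (y (n - size w)%N) (rev w) n.

Definition ray_ray (y : left_ray) (r : right_ray) : int -> A :=
  fun i => match i with Posz n => r n | Negz n => y n end.

Definition past_word (X : set (int -> A)) (w : seq A) : set left_ray :=
  [set y | left_rays X y /\ left_rays X (ray_word y w)].

Definition past_ray (X : set (int -> A)) (r : right_ray) : set left_ray :=
  [set y | left_rays X y /\ X (ray_ray y r)].

Definition lpast_word (X : set (int -> A)) (l : nat) (w : seq A) :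
    set (seq A) :=
  [set v | [/\ language X v, (size v <= l)%N & language X (v ++ w)]].

Definition lpast_ray (X : set (int -> A)) (l : nat) (r : right_ray) :
    set (seq A) :=
  [set v | [/\ language X v, (size v <= l)%N & right_rays X (word_ray v r)]].

Definition condition_star (X : set (int -> A)) : Prop :=
  forall (l : nat) (F : set (seq A)),
    F `<=` language X -> infinite_set F ->
    (forall u v, F u -> F v -> lpast_word X l u = lpast_word X l v) ->
    exists2 r, right_rays X r &
      forall w, F w -> lpast_word X l w = lpast_ray X l r.

End SymbolicDynamics.

(** A labelled graph on a set of vertices taken in V, with at most one edge of
    given source, label and target: [edge G v a w] is an edge labelled a from v
    to w. *)
Record lgraph (A V : Type) := LGraph {
  vert : set V;
  edge : V -> A -> V -> Prop;
  edge_src : forall v a w, edge v a w -> vert v;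
  edge_tgt : forall v a w, edge v a w -> vert w
}.

Definition subgraph (A V : Type) (H G : lgraph A V) : Prop :=
  vert H `<=` vert G /\ (forall v a w, edge H v a w -> edge G v a w).

Definition essential (A V : Type) (G : lgraph A V) : Prop :=
  forall v, vert G v ->
    (exists a w, edge G v a w) /\ (exists a u, edge G u a v).

(** Essential subgraphs are closed under unions, so a maximal one is the
    largest one. *)
Definition is_maximal_essential_subgraph (A V : Type) (H G : lgraph A V) :
    Prop :=
  [/\ subgraph H G, essential H &
      forall K : lgraph A V, subgraph K G -> essential K -> subgraph K H].

Section Covers.
Variables (A : finType) (X : set (int -> A)).

Definition krieger_vert : set (set (left_ray A)) :=
  [set P | exists2 r, right_rays X r & P = past_ray X r].

Definition krieger_edge (P : set (left_ray A)) (a : A)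
    (P' : set (left_ray A)) : Prop :=
  exists r, [/\ right_rays X r, right_rays X (word_ray [:: a] r),
                P = past_ray X (word_ray [:: a] r) & P' = past_ray X r].

Lemma krieger_edge_src P a P' : krieger_edge P a P' -> krieger_vert P.
Proof. by case=> r [_ ar -> _]; exists (word_ray [:: a] r). Qed.

Lemma krieger_edge_tgt P a P' : krieger_edge P a P' -> krieger_vert P'.
Proof. by case=> r [Xr _ _ ->]; exists r. Qed.

Definition left_krieger_cover : lgraph A (set (left_ray A)) :=
  LGraph krieger_edge_src krieger_edge_tgt.

Definition past_set_vert : set (set (left_ray A)) :=
  [set P | exists2 w, language X w & P = past_word X w].

Definition past_set_edge (P : set (left_ray A)) (a : A)
    (P' : set (left_ray A)) : Prop :=
  exists w, [/\ language X w, language X (a :: w),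
                P = past_word X (a :: w) & P' = past_word X w].

Lemma past_set_edge_src P a P' : past_set_edge P a P' -> past_set_vert P.
Proof. by case=> w [_ aw -> _]; exists (a :: w). Qed.

Lemma past_set_edge_tgt P a P' : past_set_edge P a P' -> past_set_vert P'.
Proof. by case=> w [Xw _ _ ->]; exists w. Qed.

Definition past_set_cover : lgraph A (set (left_ray A)) :=
  LGraph past_set_edge_src past_set_edge_tgt.

End Covers.

(* Main.v *)
(* Gluing paths of the presenting graph shows that only finitely many pasts
   P_oo(w) occur, and compactness that P_oo(r) = P_oo(w) for some prefix w of
   the right-ray r, so the left Krieger cover is an essential subgraph of the
   past set cover. The vertices of the maximal essential subgraph are the
   recurrent pasts, those equal to P_oo(w) for infinitely many words w: walking
   forward from a vertex of an essential subgraph gives arbitrarily long such w,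
   and conversely the pigeonhole principle gives every recurrent past a recurrent
   successor and predecessor. The theorem thus says that condition (star) holds
   iff every recurrent past is the past of a right-ray. For this one uses that
   an infinite F contains infinitely many words with the same past, and that
   P_oo(w) is determined by the sets P_l(w), by compactness. *)
Require Import Defs.
From mathcomp Require Import all_boot all_order all_algebra.
From mathcomp Require Import all_classical.
From mathcomp Require Import zify.

Set Implicit Arguments.
Unset Strict Implicit.
Unset Printing Implicit Defensive.

Import GRing.Theory.
Local Open Scope classical_set_scope.

(** * Infinite sets, pigeonhole and Koenig's lemma *)

Lemma infinite_pigeonhole (T U : Type) (f : T -> U) (D : set T) :
  infinite_set D -> finite_set (f @` D) ->
  exists u, infinite_set (D `&` f @^-1` [set u]).
Proof.
move=> infD finfD; apply: contrapT => nofib; apply: infD.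
apply: (@sub_finite_set _ _
  (\bigcup_(u in f @` D) (D `&` f @^-1` [set u]))).
  by move=> x Dx; exists (f x) => //; exists x.
apply: bigcup_finite => // u _.
by apply: contrapT => infu; apply: nofib; exists u.
Qed.

Lemma infinite_nat_ge (D : set nat) (m : nat) :
  infinite_set D -> exists2 n, D n & m <= n.
Proof.
move=> infD; apply: contrapT => noge; apply: infD.
apply: (@sub_finite_set _ _ `I_m) => [n Dn|]; last exact: finite_II.
by rewrite /= ltnNge; apply/negP => mn; apply: noge; exists n.
Qed.

Lemma infinite_unbounded (T : Type) (f : T -> nat) (D : set T) :
  (forall m, exists2 x, D x & m <= f x) -> infinite_set D.
Proof.
move=> unb finD.
have : infinite_set [set: nat] := infinite_nat.
apply; apply: (@sub_finite_set _ _ (\bigcup_(k in f @` D) `I_k.+1)).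
  by move=> m _; have [x Dx mx] := unb m; exists (f x) => //; exists x.
by apply: bigcup_finite => [|k _]; [exact: finite_image|exact: finite_II].
Qed.

(** As [T] is finite, a prefix shared by infinitely many [q n] extends by some letter to another
    such prefix; [g] is the limit of these prefixes. *)
Lemma koenig (T : finType) (q : nat -> nat -> T) :
  exists g, forall m, exists2 n, m <= n & forall k, k < m -> q n k = g k.
Proof.
pose good (s : seq T) := infinite_set [set n | mkseq (q n) (size s) = s].
have step (s : {s | good s}) : {t : {s | good s} | exists e,
    sval t = rcons (sval s) e}.
  case: s => s gs; apply: cid.
  have [|e inf_e] := @infinite_pigeonhole _ _ (fun n => q n (size s)) _ gs.
    exact: finite_finset.
  suff ge : good (rcons s e) by exists (exist _ _ ge); exists e.
  apply: sub_infinite_set inf_e => n [/= sn en].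
  by rewrite size_rcons mkseqS sn en.
have good0 : good [::].
  by apply: (sub_infinite_set _ infinite_nat).
have [S [S0 Sstep]] := dependent_choice step (exist _ _ good0).
have [e0] : exists e0 : T, True.
  by have [e _] := Sstep 0; exists e.
move=> _; pose g k := last e0 (sval (S k.+1)).
have Sg m : sval (S m) = mkseq g m.
  elim: m => [|m IHm]; first by rewrite S0.
  rewrite mkseqS -IHm /g.
  by have [e ->] := Sstep m; rewrite last_rcons.
exists g => m; have [n + mn] := infinite_nat_ge m (svalP (S m)).
rewrite Sg /= size_mkseq => eqn; exists n => // k km.
by rewrite -(nth_mkseq e0 (q n) km) eqn nth_mkseq.
Qed.

(** * Concatenation of words and rays *)

Section Rays.
Variable A : finType.
Implicit Types (y : left_ray A) (r : right_ray A) (v w : seq A).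

Lemma ray_word_lt y w n a : n < size w -> ray_word y w n = nth a (rev w) n.
Proof. by move=> nw; apply: set_nth_default; rewrite size_rev. Qed.

Lemma ray_word_ge y w n : size w <= n -> ray_word y w n = y (n - size w).
Proof. by move=> wn; rewrite /ray_word nth_default // size_rev. Qed.

Lemma ray_word_cat y v w : ray_word y (v ++ w) = ray_word (ray_word y v) w.
Proof.
apply/funext => n; rewrite /ray_word rev_cat nth_cat size_rev size_cat.
case: ltnP => nw; first by apply: set_nth_default; rewrite size_rev.
by rewrite [RHS]nth_default ?size_rev// addnC subnDA.
Qed.

Lemma ray_word_mkseq y n :
  ray_word (fun k => y (k + n)) (rev (mkseq y n)) = y.
Proof.
apply/funext => k; rewrite /ray_word revK size_rev size_mkseq.
case: (ltnP k n) => kn; first by rewrite nth_mkseq.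
by rewrite nth_default ?size_mkseq// subnK.
Qed.

(** Both sides read the biinfinite sequence [y v r]; moving its origin from after [v] to before [v]
    shifts the index by the length of [v]. *)
Lemma ray_ray_word y v r i :
  ray_ray (ray_word y v) r i = ray_ray y (word_ray v r) (i + (size v)%:Z)%R.
Proof.
case: i => n.
  have -> : (Posz n + size v)%R = Posz (n + size v) by [].
  by rewrite /= /word_ray nth_default ?leq_addl// addnK.
rewrite /= /ray_word; case: (ltnP n (size v)) => nv.
  have -> : (Negz n + size v)%R = Posz (size v - n.+1) by lia.
  rewrite /= /word_ray nth_rev//; apply: set_nth_default.
  by rewrite ltn_subrL (leq_trans _ nv).
have -> : (Negz n + size v)%R = Negz (n - size v) by lia.
by rewrite nth_default// size_rev.
Qed.

Lemma ray_ray_split (x : int -> A) :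
  ray_ray (fun n => x (Negz n)) (fun n => x (Posz n)) = x.
Proof. by apply/funext; case. Qed.

End Rays.

(** * Language, rays and pasts of a sofic shift *)

Section Sofic.
Variables (A : finType) (X : set (int -> A)).
Hypothesis soficX : sofic X.
Implicit Types (y : left_ray A) (r : right_ray A) (v w : seq A).

Lemma sofic_shiftz (x : int -> A) (k : int) : X x -> X (fun i => x (i + k)%R).
Proof.
have [V [E [src [tgt [lab ->]]]]] := soficX => -[p [p_path p_lab]].
exists (fun i => p (i + k)%R); split=> i; last exact: p_lab.
by rewrite p_path addrAC.
Qed.

Lemma sofic_word_ray y v r :
  X (ray_ray (ray_word y v) r) <-> X (ray_ray y (word_ray v r)).
Proof.
have e : ray_ray (ray_word y v) r =
    fun i => ray_ray y (word_ray v r) (i + size v)%R.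
  by apply/funext => i; rewrite ray_ray_word.
split=> [|Xx]; last by rewrite e; exact: sofic_shiftz.
rewrite e => /(@sofic_shiftz _ (- (size v)%:Z)).
by congr X; apply/funext => i; rewrite subrK.
Qed.

Lemma left_raysP y : left_rays X y <-> exists r, X (ray_ray y r).
Proof.
split=> [[x Xx yx]|[r Xyr]]; last by exists (ray_ray y r).
exists (fun n => x (Posz n)).
by rewrite (_ : y = fun n => x (Negz n)) ?ray_ray_split//; apply/funext.
Qed.

Lemma right_raysP r : right_rays X r <-> exists y, past_ray X r y.
Proof.
split=> [[x Xx rx]|[y [_ Xyr]]]; last by exists (ray_ray y r).
exists (fun n => x (Negz n)); suff Xr : X (ray_ray (fun n => x (Negz n)) r).
  by split=> //; apply/left_raysP; exists r.
by rewrite (_ : r = fun n => x (Posz n)) ?ray_ray_split//; apply/funext.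
Qed.

Lemma past_rayE r y : past_ray X r y <-> X (ray_ray y r).
Proof. by split=> [[]|Xyr]//; split=> //; apply/left_raysP; exists r. Qed.

Lemma past_wordE w y : past_word X w y <-> left_rays X (ray_word y w).
Proof.
split=> [[]|Xyw]//; split=> //.
have /left_raysP[r /sofic_word_ray Xyr] := Xyw.
by apply/left_raysP; exists (word_ray w r).
Qed.

(** Reduces membership in the language to nonemptiness of the past, so that words with equal pasts
    are allowed together. *)
Lemma languageP w : language X w <-> exists y, past_word X w y.
Proof.
split=> [[x Xx [i wE]]|[y /past_wordE[x Xx xE]]].
  (* The left-ray is what precedes the occurrence of [w] in [x]; the shift then puts the last letter
     of [w] at position -1. *)
  exists (fun n => x (i - (n.+1)%:Z)%R); apply/past_wordE.
  exists (fun j => x (j + (i + size w))%R); first exact: sofic_shiftz.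
  move=> n; case: (ltnP n (size w)) => nw.
    rewrite (ray_word_lt _ (x 0%R) nw) nth_rev// {1}wE nth_mkseq; last by lia.
    by congr x; lia.
  by rewrite ray_word_ge//; congr x; lia.
exists x => //; exists (- (size w)%:Z)%R.
apply: (@eq_from_nth _ (x 0%R)); first by rewrite size_mkseq.
move=> k kw; rewrite nth_mkseq//.
have -> : (- (size w)%:Z + k)%R = Negz (size w - k.+1) by lia.
have kw' : size w - k.+1 < size w by lia.
by rewrite -xE (ray_word_lt _ (x 0%R) kw') nth_rev//; congr nth; lia.
Qed.

Lemma past_word_cat v w y :
  past_word X (v ++ w) y <-> past_word X w (ray_word y v).
Proof. by rewrite !past_wordE ray_word_cat. Qed.

Lemma past_ray_cat v r y :
  past_ray X (word_ray v r) y <-> past_ray X r (ray_word y v).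
Proof. by rewrite !past_rayE sofic_word_ray. Qed.

(** Recovers [P_l] from [P_oo]: applied to the past of a word or of a right-ray it gives [P_l],
    which thus depends on the past alone. *)
Definition lpast (l : nat) (P : set (left_ray A)) : set (seq A) :=
  [set v | size v <= l /\ exists y, P (ray_word y v)].

Lemma lpast_wordE l w : lpast_word X l w = lpast l (past_word X w).
Proof.
apply/seteqP; split=> v /=.
  by case=> _ vl /languageP[y /past_word_cat Py]; split=> //; exists y.
case=> vl [y Py]; split=> //; apply/languageP; exists y.
  by apply/past_wordE; case: Py.
exact/past_word_cat.
Qed.

Lemma lpast_rayE l r : lpast_ray X l r = lpast l (past_ray X r).
Proof.
apply/seteqP; split=> v /=.
  by case=> _ vl /right_raysP[y /past_ray_cat Py]; split=> //; exists y.
case=> vl [y Py]; split=> //.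
  by apply/languageP; exists y; apply/past_wordE; case: Py.
by apply/right_raysP; exists y; apply/past_ray_cat.
Qed.

(** * Compactness and finiteness of the set of pasts *)

(** Koenig's lemma is applied to the presenting paths: a limit of paths is again a path, and its
    labels form [z]. *)
Lemma sofic_compact (x : nat -> int -> A) : (forall n, X (x n)) ->
  exists2 z, X z &
    forall m, exists2 n, m <= n & forall i : int, absz i <= m -> x n i = z i.
Proof.
have [V [E [src [tgt [lab XE]]]]] := soficX; rewrite XE => Xx.
have [p pP] := choice Xx.
have [g gP] := koenig (fun n k => (p n (Posz k), p n (Negz k))).
pose q (i : int) := match i with Posz k => (g k).1 | Negz k => (g k).2 end.
have qP m : exists2 n, m <= n & forall i : int, absz i <= m -> p n i = q i.
  have [n mn pg] := gP m.+1; exists n; first exact: ltnW.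
  by case=> k km; rewrite /q -pg//= ; lia.
exists (fun i => lab (q i)).
  exists q; split=> // i; have [n _ pq] := qP (maxn (absz i) (absz (i + 1)%R)).
  by rewrite -!pq ?leq_maxl ?leq_maxr//; case: (pP n).
move=> m; have [n mn pq] := qP m; exists n => // i im.
by rewrite -pq//; case: (pP n).
Qed.

Lemma sofic_closed (z : int -> A) :
  (forall m, exists2 x, X x & forall i : int, absz i <= m -> x i = z i) -> X z.
Proof.
move=> zP.
have /choice[x xP] m :
    exists x, X x /\ forall i : int, absz i <= m -> x i = z i.
  by have [x] := zP m; exists x.
have [|t Xt tP] := @sofic_compact x; first by move=> n; case: (xP n).
suff -> : z = t by [].
apply/funext => i; have [n mn xt] := tP (absz i).
by rewrite -xt//; have [_ ->] := xP n.
Qed.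

Lemma left_rays_closed y :
  (forall m, exists2 y', left_rays X y' & forall n, n < m -> y' n = y n) ->
  left_rays X y.
Proof.
move=> yP.
have /choice[x xP] m : exists x, X x /\ forall n, n < m -> x (Negz n) = y n.
  have [y' [x Xx xy'] y'y] := yP m; exists x; split=> // n nm.
  by rewrite -xy' y'y.
have [|t Xt tP] := @sofic_compact x; first by move=> n; case: (xP n).
exists t => // k; have [n kn xt] := tP k.+1.
by rewrite -xt//; have [_ ->] := xP n.
Qed.

Lemma past_word_closed w y :
  (forall m, exists2 y', past_word X w y' & forall n, n < m -> y' n = y n) ->
  past_word X w y.
Proof.
move=> yP; apply/past_wordE/left_rays_closed => m.
have [y' /past_wordE Xy' y'y] := yP m; exists (ray_word y' w) => // n nm.
case: (ltnP n (size w)) => nw; first by rewrite !(ray_word_lt _ (y 0) nw).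
by rewrite !ray_word_ge// y'y//; lia.
Qed.

(** Every final segment of a left-ray [y] in [P] also ends a left-ray in the past of [w], and that
    past is closed. *)
Lemma subset_past_word w (P : set (left_ray A)) :
  (forall l, lpast l P `<=` lpast l (past_word X w)) -> P `<=` past_word X w.
Proof.
move=> sub y Py; apply: past_word_closed => m.
have [|_ [y' Py']] := sub m (rev (mkseq y m)).
  split; first by rewrite size_rev size_mkseq.
  by exists (fun k => y (k + m)); rewrite ray_word_mkseq.
exists (ray_word y' (rev (mkseq y m))) => // n nm.
have nm' : n < size (rev (mkseq y m)) by rewrite size_rev size_mkseq.
by rewrite (ray_word_lt _ (y 0) nm') revK nth_mkseq.
Qed.

Lemma past_word_inj w w' :
  (forall l, lpast_word X l w = lpast_word X l w') ->
  past_word X w = past_word X w'.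
Proof.
move=> eqw; apply/seteqP; split; apply: subset_past_word => l;
  by rewrite -!lpast_wordE eqw.
Qed.

(* Paths can be glued at position 0, so the past of w depends only on the set of
   vertices from which w can be read. *)
Lemma finite_past_word : finite_set (range (past_word X)).
Proof.
have [V [E [src [tgt [lab XE]]]]] := soficX.
pose path (p : int -> E) := forall i : int, tgt (p i) = src (p (i + 1)%R).
pose S w : set V := [set s | exists p, [/\ path p, src (p 0%R) = s &
  exists r, forall n : nat, lab (p n) = word_ray w r n]].
pose phi (B : {set V}) : set (left_ray A) :=
  [set y | exists p, [/\ path p, src (p 0%R) \in B &
     forall n, lab (p (Negz n)) = y n]].
apply: (@sub_finite_set _ _ (range phi)); last first.
  exact/finite_image/finite_finset.
move=> _ [w _ <-]; exists [set s | `[< S w s >]]%SET => //.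
apply/seteqP; split=> y.
  case=> p [p_path]; rewrite inE => /asboolP[q [q_path q0 [r qr]]] py.
  apply/past_wordE/left_raysP; exists r; apply/sofic_word_ray; rewrite XE.
  exists (fun i => match i with Posz _ => q i | Negz _ => p i end).
  split=> [[n|[|n]]|[n|n]] //; rewrite ?p_path//.
move=> /past_wordE/left_raysP[r /sofic_word_ray]; rewrite {1}XE => -[p [pp pl]].
exists p; split=> //.
rewrite inE; apply/asboolP; exists p; split=> //; exists r => n; exact: pl.
Qed.

(** By finiteness infinitely many prefixes share one past; a left-ray in it precedes arbitrarily
    long prefixes of [r], hence [r] itself since [X] is closed. *)
Lemma past_ray_prefix r : exists n, past_ray X r = past_word X (mkseq r n).
Proof.
have [|P infP] := @infinite_pigeonhole _ _ (fun n => past_word X (mkseq r n)) _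
    infinite_nat.
  by apply: sub_finite_set finite_past_word => _ [n _ <-]; exists (mkseq r n).
have [n0 [_ /= n0P] _] := infinite_nat_ge 0 infP.
have rE n : r = word_ray (mkseq r n) (fun k => r (k + n)).
  apply/funext => k; rewrite /word_ray size_mkseq.
  case: (ltnP k n) => kn; first by rewrite nth_mkseq.
  by rewrite nth_default ?size_mkseq// subnK.
exists n0; apply/seteqP; split=> y.
  move/past_rayE; rewrite {1}(rE n0) -sofic_word_ray => Xy.
  by apply/past_wordE/left_raysP; eexists; exact: Xy.
rewrite n0P => Py; apply/past_rayE/sofic_closed => m.
have [n [_ /= nP] mn] := infinite_nat_ge m.+1 infP.
move: Py; rewrite -nP => /past_wordE/left_raysP[r' /sofic_word_ray Xy].
exists (ray_ray y (word_ray (mkseq r n) r')) => // -[k|k]//= km.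
rewrite /word_ray (@set_nth_default _ _ (r 0)) ?nth_mkseq ?size_mkseq//; lia.
Qed.

End Sofic.

(** * The left Krieger cover inside the past set cover *)

Section Covers.
Variables (A : finType) (X : set (int -> A)).
Hypothesis soficX : sofic X.
Implicit Types (r : right_ray A) (v w : seq A) (P : set (left_ray A)).

(** The past of [v ++ w] depends only on [v] and the past of [w], so equal pasts stay equal when the
    same letters are prepended. *)
Lemma past_word_catE v w :
  past_word X (v ++ w) = [set y | past_word X w (ray_word y v)].
Proof. by apply/seteqP; split=> y /(past_word_cat soficX). Qed.

Lemma past_word_consE a w :
  past_word X (a :: w) = [set y | past_word X w (ray_word y [:: a])].
Proof. exact: (past_word_catE [:: a]). Qed.

Lemma past_ray_catE v r :
  past_ray X (word_ray v r) = [set y | past_ray X r (ray_word y v)].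
Proof. by apply/seteqP; split=> y /(past_ray_cat soficX). Qed.

Lemma past_ray_word r :
  right_rays X r -> exists2 w, language X w & past_ray X r = past_word X w.
Proof.
move=> /right_raysP[y Py].
have [n rn] := past_ray_prefix soficX r; exists (mkseq r n) => //.
by apply/(languageP soficX); exists y; rewrite -rn.
Qed.

Lemma past_word_extend w : language X w -> exists a, language X (a :: w).
Proof.
(* Left-rays are numbered from right to left, so [y 0] is the symbol just before [w]. *)
move=> /(languageP soficX)[y Py]; exists (y 0).
apply/(languageP soficX); exists (fun k => y (k + 1)).
by rewrite -cat1s; apply/(past_word_cat soficX); rewrite (ray_word_mkseq y 1).
Qed.

Lemma right_ray_extend r :
  right_rays X r -> exists a, right_rays X (word_ray [:: a] r).
Proof.
move=> /right_raysP[y Py]; exists (y 0).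
apply/right_raysP; exists (fun k => y (k + 1)).
by apply/(past_ray_cat soficX); rewrite (ray_word_mkseq y 1).
Qed.

Lemma language_behead a w : language X (a :: w) -> language X w.
Proof.
move=> /(languageP soficX)[y]; rewrite -cat1s => /(past_word_cat soficX) Py.
by apply/(languageP soficX); eexists; exact: Py.
Qed.

Lemma krieger_sub_past_set :
  subgraph (left_krieger_cover X) (past_set_cover X).
Proof.
split=> [P [r Xr ->]|P a P' [r [Xr Xar -> ->]]]; first exact: past_ray_word.
have [w Xw rw] := past_ray_word Xr.
have aw : past_ray X (word_ray [:: a] r) = past_word X (a :: w).
  by rewrite past_ray_catE past_word_consE rw.
exists w; split=> //; apply/(languageP soficX).
by have /right_raysP[y] := Xar; rewrite aw; exists y.
Qed.

Lemma krieger_essential : essential (left_krieger_cover X).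
Proof.
move=> P [r Xr ->]; split; last first.
  have [a Xar] := right_ray_extend Xr.
  by exists a, (past_ray X (word_ray [:: a] r)), r.
pose r' := (fun k => r k.+1) : right_ray A.
have rE : r = word_ray [:: r 0] r'.
  by apply/funext => -[|k] //; rewrite /word_ray /= nth_nil /r' subn1.
exists (r 0), (past_ray X r'), r'; rewrite -rE; split=> //.
move: Xr => /right_raysP[y]; rewrite {1}rE.
move=> /(past_ray_cat soficX) Py.
by apply/right_raysP; eexists; exact: Py.
Qed.

(** * Recurrent pasts *)

Definition recurrent_past P :=
  infinite_set [set w | language X w /\ past_word X w = P].

(** Given an edge labelled [a] from [P] to [P'] and a word [w'] of length at least [m] with past
    [P'], the longer word [a :: w'] has past [P]. *)
Lemma essential_recurrent (K : lgraph A (set (left_ray A))) P :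
  subgraph K (past_set_cover X) -> essential K -> vert K P -> recurrent_past P.
Proof.
move=> [_ Kedge] Kess KP; apply: (@infinite_unbounded _ size) => m.
elim: m P KP => [|m IHm] P KP.
  have [[a [P' /Kedge[w [_ Xaw -> _]]]] _] := Kess _ KP.
  by exists (a :: w).
have [[a [P' KPP']] _] := Kess _ KP.
have [w' [Xw' w'P'] mw'] := IHm P' (edge_tgt KPP').
have [w [_ Xaw Pw P'w]] := Kedge _ _ _ KPP'.
have aww' : past_word X (a :: w) = past_word X (a :: w').
  by rewrite !past_word_consE w'P' P'w.
exists (a :: w') => //; split; last by rewrite Pw.
by have /(languageP soficX)[y] := Xaw; rewrite aww' => ?;
  apply/(languageP soficX); exists y.
Qed.

(** Only finitely many pairs of a first letter and a past of the remaining word occur, so infinitely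
    many words with past [P] share such a pair. *)
Lemma recurrent_edge_src P : recurrent_past P ->
  exists a P', past_set_edge X P a P' /\ recurrent_past P'.
Proof.
move=> infP.
pose D : set (seq A) := [set w | language X w /\ past_word X w = P] `\ [::].
have infD : infinite_set D by apply: infinite_setD.
have [a0] : exists a0 : A, True.
  by have [[|a w] [_ w0]] := infinite_setN0 infD; [case: w0|exists a].
move=> _.
pose f w := (head a0 w, past_word X (behead w)).
have [|[a P'] infD'] := @infinite_pigeonhole _ _ f _ infD.
  apply: (@sub_finite_set _ _ ([set: A] `*` range (past_word X))).
    by move=> _ [w _ <-]; split=> //=; exists (behead w).
  apply: finite_setX; [exact: finite_finset|exact: finite_past_word].
have D'E w : (D `&` f @^-1` [set (a, P')]) w -> exists u,
    [/\ w = a :: u, language X u, past_word X u = P' & past_set_edge X P a P'].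
  case: w => [|b u]; first by case=> -[_ []].
  case=> -[[Xbu buP] _] /= [ba uP']; subst b; exists u.
  have Xu := language_behead Xbu.
  by split=> //; exists u; rewrite uP'.
exists a, P'; split.
  by have [w /D'E[u []]] := infinite_setN0 infD'.
move=> finP'; apply: infD'.
apply: sub_finite_set (finite_image (cons a) finP') => w /D'E[u [-> Xu uP' _]].
by exists u.
Qed.

(** A letter that can precede one word with past [P'] can precede all of them; the longer words are
    distinct and share one past. *)
Lemma recurrent_edge_tgt P' : recurrent_past P' ->
  exists a P, past_set_edge X P a P' /\ recurrent_past P.
Proof.
move=> infP'; have [w0 [Xw0 w0P']] := infinite_setN0 infP'.
have [a Xaw0] := past_word_extend Xw0.
exists a, (past_word X (a :: w0)); split; first by exists w0.
move=> finP; apply: infP'.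
apply: sub_finite_set (finite_image behead finP) => w [Xw wP'].
have aw : past_word X (a :: w) = past_word X (a :: w0).
  by rewrite !past_word_consE wP' w0P'.
exists (a :: w) => //; split=> //; apply/(languageP soficX).
by have /(languageP soficX)[y] := Xaw0; rewrite -aw; exists y.
Qed.

Definition recurrent_edge P a P' :=
  [/\ past_set_edge X P a P', recurrent_past P & recurrent_past P'].

Lemma recurrent_edgeS P a P' : recurrent_edge P a P' -> recurrent_past P.
Proof. by case. Qed.

Lemma recurrent_edgeT P a P' : recurrent_edge P a P' -> recurrent_past P'.
Proof. by case. Qed.

Definition recurrent_graph : lgraph A (set (left_ray A)) :=
  LGraph recurrent_edgeS recurrent_edgeT.

Lemma recurrent_sub_past_set : subgraph recurrent_graph (past_set_cover X).
Proof.
split=> [P infP|P a P' []//].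
by have [w [Xw <-]] := infinite_setN0 infP; exists w.
Qed.

Lemma recurrent_essential : essential recurrent_graph.
Proof.
move=> P infP; split.
  by have [a [P' []]] := recurrent_edge_src infP; exists a, P'.
by have [a [P' []]] := recurrent_edge_tgt infP; exists a, P'.
Qed.

(** * The two directions of the equivalence *)

Lemma lpast_subl l l' P Q : l <= l' -> lpast l' P = lpast l' Q ->
  lpast l P = lpast l Q.
Proof.
move=> ll' PQ.
have lpastE R : lpast l R = lpast l' R `&` [set v | size v <= l].
  apply/seteqP; split=> v [vl Rv]; last by split=> //; case: vl.
  by split=> //; split=> //; exact: leq_trans ll'.
by rewrite !lpastE PQ.
Qed.

(* Condition (star) gives one ray per length l; as only finitely many pasts
   occur, a single ray serves infinitely many, hence all, lengths. *)
Lemma star_krieger_vert P :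
  condition_star X -> recurrent_past P -> krieger_vert X P.
Proof.
move=> star infP.
have /choice[r rP] l : exists r, right_rays X r /\
    forall w, language X w /\ past_word X w = P ->
      lpast_word X l w = lpast_ray X l r.
  have [||r Xr rP] := star l _ _ infP; [by move=> w []| |by exists r].
  by move=> u v [_ uP] [_ vP]; rewrite !(lpast_wordE soficX) uP vP.
have [|Q infQ] := @infinite_pigeonhole _ _ (fun l => past_ray X (r l)) _
    infinite_nat.
  apply: sub_finite_set (finite_past_word soficX) => _ [l _ <-].
  by have [w _ ->] := past_ray_word (rP l).1; exists w.
have [l0 [_ /= l0Q] _] := infinite_nat_ge 0 infQ.
exists (r l0); first exact: (rP l0).1.
have [w0 Xw0 w0E] := past_ray_word (rP l0).1.
have [w [Xw wP]] := infinite_setN0 infP.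
rewrite w0E -wP; apply: past_word_inj => // l.
(* [r l'] has the same past as [r l0] and agrees with [w] on [P_l'], hence on [P_l]. *)
have [l' [_ /= l'Q] ll'] := infinite_nat_ge l infQ.
rewrite !(lpast_wordE soficX); apply: (lpast_subl ll').
by rewrite -(lpast_wordE soficX) (rP l').2// (lpast_rayE soficX) l'Q -l0Q w0E.
Qed.

(** Vertices of [K] are recurrent, hence pasts of rays. An edge of [K] labelled [a] into the past of
    [r] must start at the past of [a r]. *)
Lemma star_maximal : condition_star X ->
  is_maximal_essential_subgraph (left_krieger_cover X) (past_set_cover X).
Proof.
move=> star; split; [exact: krieger_sub_past_set|exact: krieger_essential|].
move=> K subK essK.
have vertK P : vert K P -> krieger_vert X P.
  by move=> KP; apply/star_krieger_vert/(essential_recurrent subK essK).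
split=> [|P a P' KPP']; first exact: vertK.
have [r Xr rP'] := vertK _ (edge_tgt KPP').
have [w [_ Xaw Pw P'w]] := subK.2 _ _ _ KPP'.
have aE : past_word X (a :: w) = past_ray X (word_ray [:: a] r).
  by rewrite past_ray_catE past_word_consE -P'w rP'.
exists r; split=> //; last by rewrite Pw.
apply/right_raysP.
by have /(languageP soficX)[y] := Xaw; rewrite aE; exists y.
Qed.

(** The recurrent pasts form an essential subgraph, so maximality makes each of them the past of a
    ray; this is applied to a past shared by infinitely many words of [F]. *)
Lemma maximal_star :
  is_maximal_essential_subgraph (left_krieger_cover X) (past_set_cover X) ->
  condition_star X.
Proof.
move=> [_ _ maxX] l F FX infF Fl.
have [|P infFP] := @infinite_pigeonhole _ _ (past_word X) _ infF.
  by apply: sub_finite_set (finite_past_word soficX) => _ [w _ <-]; exists w.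
have recP : recurrent_past P.
  by apply: sub_infinite_set infFP => w [Fw /= wP]; split=> //; exact: FX.
have [vertX _] := maxX _ recurrent_sub_past_set recurrent_essential.
have [r Xr Pr] := vertX _ recP; exists r => // w Fw.
(* All words of [F] have the same [P_l], so the ray found for the past of [u] also serves the words
   with other pasts. *)
have [u [Fu /= uP]] := infinite_setN0 infFP.
by rewrite (Fl w u Fw Fu) (lpast_wordE soficX) uP Pr (lpast_rayE soficX).
Qed.

End Covers.

Theorem proposition3p33 (A : finType) (X : set (int -> A)) (hX : sofic_shift X) :
  condition_star X <->
  is_maximal_essential_subgraph (left_krieger_cover X) (past_set_cover X).
Proof.
case: hX => _ soficX.
by split; [exact: star_maximal|exact: maximal_star].
Qed.
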